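(* Let $0\leq p\leq 1$ and let $\boldsymbol{X}=(X_0,X_1,\dots)$ be a sequence of Bernoulli$(p)$ random variables (not assumed independent) on a probability space $(\Omega,\mathscr{F},\mathbb{P})$. Then $$\lim_{n\to\infty}\frac{1}{n}\sum_{i=0}^{n-1}X_i=p\qquad\text{almost surely}$$ if and only if there exists a sequence $\boldsymbol{\vartheta}=(\vartheta_0,\vartheta_1,\dots)$ of random variables on $(\Omega,\mathscr{F},\mathbb{P})$ taking values in the unit interval $[0,1]$ such that: (1) almost surely, for all $n\geq 0$ and all $x_0,x_1,\dots,x_n\in\{0,1\}$, $$\mathbb{P}(X_0=x_0,\dots,X_n=x_n\mid\boldsymbol{\vartheta})=\prod_{i=0}^{n}\vartheta_i^{x_i}(1-\vartheta_i)^{1-x_i};$$ and (2) almost surely, $$\lim_{n\to\infty}\frac{1}{n}\sum_{i=0}^{n-1}\vartheta_i=p.$$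
   Context: A Bernoulli$(p)$ random variable takes values in $\{0,1\}$ and equals $1$ with probability $p$. The notation $\mathbb{P}(\cdot\mid\boldsymbol{\vartheta})$ means conditional probability given the $\sigma$-field $\sigma(\boldsymbol{\vartheta})$ generated by the whole sequence $\boldsymbol{\vartheta}$. The convention $0^0=1$ is used. *)

(* Defs.v *)
From HB Require Import structures.
From mathcomp Require Import all_boot all_order all_algebra.
From mathcomp Require Import all_classical all_reals all_analysis.
From mathcomp Require Import measurable_realfun.

Set Implicit Arguments.
Unset Strict Implicit.
Unset Printing Implicit Defensive.

Import Order.TTheory GRing.Theory Num.Theory.
Import numFieldNormedType.Exports.

Local Open Scope classical_set_scope.
Local Open Scope ring_scope.

(* The preimages of the Borel sets by the theta_i; they generate
   sigma(theta) = <<s rv_seq_events theta >>. *)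
Definition rv_seq_events (d : measure_display) (T : measurableType d)
    (R : realType) (P : probability T R) (theta : nat -> {RV P >-> R})
    : set (set T) :=
  \bigcup_i g_sigma_algebra_preimage (theta i).

(* f is a version of the conditional probability P(A | <<s G >>). *)
Definition is_cond_prob (d : measure_display) (T : measurableType d)
    (R : realType) (P : probability T R) (G : set (set T)) (A : set T)
    (f : T -> R) : Prop :=
  [/\ measurable_fun [set: g_sigma_algebraType G]
        (f : g_sigma_algebraType G -> R),
      P.-integrable [set: T] (EFin \o f) &
      forall B : set T, <<s G >> B ->
        (\int[P]_(w in B) (f w)%:E = P (A `&` B))%E].

Lemma cond_prob_factor (d d' : measure_display) (T : measurableType d)
    (S : measurableType d') (R : realType) (P : probability T R)
    (phi : {mfun T >-> S}) (A : set T) :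
  measurable A ->
  exists h : S -> R, [/\ measurable_fun [set: S] h,
    P.-integrable [set: T] (EFin \o (h \o phi)) &
    forall B, measurable B ->
      (\int[P]_(w in phi @^-1` B) (h (phi w))%:E = P (A `&` phi @^-1` B))%E].
Proof.
move=> mA; have mphi : measurable_fun [set: T] phi by [].
have mphiB B : measurable B -> measurable (phi @^-1` B) by exact: measurable_funPTI.
pose PS : probability S R := distribution P phi.
have [nu0 nu0E] : exists nu0 : {measure set S -> \bar R},
    forall B, nu0 B = P (A `&` phi @^-1` B).
  unshelve eexists.
    by unshelve refine (pushforward (mrestr P mA) phi : {measure set S -> \bar R}).
  by move=> B; rewrite /= /pushforward/= /mrestr/= setIC.
have nufin : fin_num_fun nu0.
  move=> B mB; rewrite nu0E fin_num_measure//.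
  by apply: measurableI => //; exact: mphiB.
have nusig : sigma_finite [set: S] nu0.
  by apply: fin_num_fun_sigma_finite => //; rewrite measure0.
have H1 := isFinite.Build _ _ _ (Measure.sort nu0) nufin.
have H2 := isSigmaFinite.Build _ _ _ (Measure.sort nu0) nusig.
have H3 := isSFinite.Build _ _ _ (Measure.sort nu0)
  (sfinite_measure_sigma_finite nusig).
pose nu := HB.pack_for (FiniteMeasure.type S R) (Measure.sort nu0) H1 H2 H3.
have nuE B : nu B = P (A `&` phi @^-1` B) by exact: nu0E.
have nuPS : nu `<< PS.
  apply/null_content_dominatesP => B mB PB0.
  apply/eqP; rewrite eq_le measure_ge0 andbT nuE -PB0.
  apply: le_measure; rewrite ?inE//=.
  - by apply: measurableI => //; exact: mphiB.
  - exact: mphiB.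
have [h [hge0 hfin hint hE]] := radon_nikodym_sigma_finite nuPS.
have hK w : (fine (h w))%:E = h w by rewrite fineK.
have mh : measurable_fun [set: S] h by exact: measurable_int hint.
exists (fine \o h); split.
- exact: measurableT_comp.
- have -> : EFin \o ((fine \o h) \o phi) = h \o phi.
    by apply/funext => w /=; rewrite hK.
  apply/integrableP; split; first exact: measurableT_comp.
  have /integrableP[_] := hint; rewrite ge0_integral_pushforward//=.
  exact: measurableT_comp.
- move=> B mB; under eq_integral do rewrite hK.
  rewrite -nuE hE// ge0_integral_pushforward//=.
  exact: measurable_funTS.
Qed.

Lemma is_cond_prob_exists (d : measure_display) (T : measurableType d)
    (R : realType) (P : probability T R) (G : set (set T)) (A : set T) :
  G `<=` measurable -> measurable A -> exists f : T -> R, is_cond_prob P G A f.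
Proof.
move=> mG mA.
have midS : measurable_fun [set: T] (idfun : T -> g_sigma_algebraType G).
  move=> _ B mB; rewrite setTI; move: B mB.
  by apply: smallest_sub => //; exact: sigma_algebra_measurable.
pose idm : {mfun T >-> g_sigma_algebraType G} :=
  HB.pack (idfun : T -> g_sigma_algebraType G)
    (isMeasurableFun.Build _ _ _ _ _ midS).
have [h [mh hint hE]] := cond_prob_factor P idm mA; exists h; split.
- exact: mh.
- exact: hint.
- exact: hE.
Qed.

(* P(A | <<s G >>): a fixed version, unique P-almost everywhere. The default
   value cst 0 is only used outside the scope of is_cond_prob_exists. *)
Definition cond_prob (d : measure_display) (T : measurableType d)
    (R : realType) (P : probability T R) (G : set (set T)) (A : set T)
    : T -> R :=
  xget (cst 0) [set f | is_cond_prob P G A f].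

Lemma cond_probP (d : measure_display) (T : measurableType d)
    (R : realType) (P : probability T R) (G : set (set T)) (A : set T) :
  G `<=` measurable -> measurable A -> is_cond_prob P G A (cond_prob P G A).
Proof.
by move=> mG mA; have [f Pf] := is_cond_prob_exists P mG mA; exact: xgetI Pf.
Qed.

Lemma rv_seq_events_measurable (d : measure_display) (T : measurableType d)
    (R : realType) (P : probability T R) (theta : nat -> {RV P >-> R}) :
  rv_seq_events theta `<=` measurable.
Proof.
move=> A [i _ [B mB <-]]; exact: (measurable_funPT (theta i)).
Qed.

(* Main.v *)
(** If the means of [X] converge, take [theta := X]: given [X] itself, the
    cylinder events have conditional probability 0 or 1, which is what the
    product of Bernoulli weights evaluates to since [0^0 = 1].
    Conversely, conditional independence given [theta] makes the bounded
    variables [Y_i := X_i - theta_i] pairwise orthogonal in [L^2]. Hence the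
    mean of [Y] over the first [k^2] indices has second moment at most
    [1 / k^2], which is summable in [k], so these means vanish almost surely
    along the squares; as [|Y_i| <= 1], the gaps between consecutive squares
    do not matter and the means of [X] and [theta] have the same limit. *)

Require Import Defs.
From HB Require Import structures.
From mathcomp Require Import all_boot all_order all_algebra.
From mathcomp Require Import all_classical all_reals all_analysis.
From mathcomp Require Import measurable_realfun ring lra zify.

Import Order.TTheory GRing.Theory Num.Theory.
Import numFieldNormedType.Exports.

Set Implicit Arguments.
Unset Strict Implicit.
Unset Printing Implicit Defensive.

Local Open Scope classical_set_scope.
Local Open Scope ring_scope.

(** * Averages along squares and the gaps between them *)

Lemma nat_between_squares (n : nat) :
  (0 < n)%N -> exists k, (k.+1 ^ 2 <= n < k.+2 ^ 2)%N.
Proof.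
elim: n => // -[_ _|n /(_ isT)[k /andP[lk uk]] _]; first by exists 0%N.
have [n1|n1] := ltnP n.+2 (k.+2 ^ 2).
  by exists k; rewrite n1 andbT (leq_trans lk).
by exists k.+1; rewrite n1 /= (leq_ltn_trans uk)// ltn_exp2r.
Qed.

(** If [(k+1)^2 <= n < (k+2)^2], the sum of the first [n] terms exceeds the sum up to the square by
    at most [2(k+1)] terms of modulus at most 1. Divided by [n], this excess is at most
    [2/(k+1)]. *)
Lemma cvg_mean_of_squares (R : realType) (y : R^nat) :
  (forall i, `|y i| <= 1) ->
  ((k.+1 ^ 2)%:R^-1 * \sum_(i < k.+1 ^ 2) y i @[k --> \oo] --> 0) ->
  n%:R^-1 * \sum_(i < n) y i @[n --> \oo] --> 0.
Proof.
move=> y1 /cvgr0Pnorm_le sq0; apply/cvgr0Pnorm_le => e e0.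
have e20 : 0 < e / 2 by rewrite divr_gt0.
have [K _ hK] := sq0 _ e20.
(* Once [k >= m], the gap [2(k+1)] is at most [(e/3)(k+1)^2 <= (e/3)n]; with the share [e/2] of the
   square this stays below [e]. *)
have [m hm] : exists m : nat, 6 / e < m%:R.
  exists (Num.bound (6 / e)); apply: le_lt_trans (archi_boundP _) => //.
  by rewrite divr_ge0// ltW.
(* From this threshold on, the square just below [n] has index [k >= maxn K m]. *)
exists ((maxn K m).+1 ^ 2)%N => //= n /= nKm.
have n0 : (0 < n)%N by rewrite (leq_trans _ nKm)// expn_gt0.
have [k /andP[lk uk]] := nat_between_squares n0.
have : ((maxn K m).+1 < k.+2)%N by
  rewrite -(@ltn_exp2r _ _ 2)// (leq_ltn_trans nKm).
rewrite ltnS [(_ < k.+1)%N]ltnS geq_max => /andP[Kk mk].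
have {Kk}hk : `|(k.+1 ^ 2)%:R^-1 * \sum_(i < k.+1 ^ 2) y i| <= e / 2.
  exact: hK.
set N := (k.+1 ^ 2)%N in lk hk.
have N0 : 0 < N%:R :> R by rewrite ltr0n expn_gt0.
have nR0 : 0 < n%:R :> R by rewrite ltr0n.
have NnR : N%:R <= n%:R :> R by rewrite ler_nat.
rewrite -(big_mkord xpredT y) (big_cat_nat (n := N))//= big_mkord.
have tl : `|\sum_(N <= i < n) y i| <= 2 * k.+1%:R.
  apply: le_trans (ler_norm_sum _ _ _) _.
  apply: (@le_trans _ _ (\sum_(N <= i < n) 1)); first exact: ler_sum.
  rewrite sumr_const_nat -natrM ler_nat; move: uk; rewrite /N.
  nia.
have hd : `|\sum_(i < N) y i| <= e / 2 * N%:R.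
  by rewrite -ler_pdivrMr// mulrC -[N%:R^-1]ger0_norm ?invr_ge0// -normrM.
rewrite normrM [`|_^-1|]ger0_norm ?invr_ge0// mulrC ler_pdivrMr//.
apply: le_trans (ler_normD _ _) _.
have NE : N%:R = k.+1%:R ^+ 2 :> R by rewrite natrX.
have mk' : m%:R <= k.+1%:R :> R by rewrite ler_nat (leq_trans mk).
have k6 : 6 < e * k.+1%:R.
  by move: hm; rewrite ltr_pdivrMr// mulrC => /lt_le_trans; apply; rewrite ler_pM2l.
have k0 : 0 < k.+1%:R :> R by [].
have : 6 * k.+1%:R <= e * N%:R by rewrite NE expr2 mulrA ler_pM2r// ltW.
have : e * N%:R <= e * n%:R by rewrite ler_pM2l.
lra.
Qed.

Lemma sum_inv_squares_le2 (R : realType) (n : nat) :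
  \sum_(0 <= k < n) (k.+1 ^ 2)%:R^-1 <= 2 :> R.
Proof.
case: n => [|n]; first by rewrite big_nil.
(* The sharper bound is inductive: with [x = n+1], the slack gained at each step is
   [1/x - 1/(x+1) - 1/(x+1)^2 = 1/(x(x+1)^2)]. *)
suff : \sum_(0 <= k < n.+1) (k.+1 ^ 2)%:R^-1 <= 2 - n.+1%:R^-1 :> R.
  by move=> /le_trans; apply; rewrite gerBl.
elim: n => [|n IHn]; first by rewrite big_nat1 exp1n invr1; lra.
rewrite big_nat_recr//=; apply: le_trans (lerD IHn (lexx _)) _.
rewrite -addrA lerD2l -subr_ge0 natrX -[n.+2%:R]natr1.
have n0 : 0 < n.+1%:R :> R by [].
move: n.+1%:R n0 => x x0.
have -> : - (x + 1)^-1 - (- x^-1 + ((x + 1) ^+ 2)^-1) = (x * (x + 1) ^+ 2)^-1.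
  by field; rewrite !gt_eqF// addr_gt0.
by rewrite invr_ge0 mulr_ge0// ?sqr_ge0 ?ltW.
Qed.

(** * A strong law for bounded orthogonal variables *)

Lemma probability_integrable_bounded (d : measure_display)
    (T : measurableType d) (R : realType) (P : probability T R) (D : set T)
    (f : T -> R) (M : R) :
  measurable D -> measurable_fun D f -> (forall w, D w -> `|f w| <= M) ->
  P.-integrable D (EFin \o f).
Proof.
move=> mD mf fM; apply: measurable_bounded_integrable => //.
  by rewrite (le_lt_trans (probability_le1 P mD))// ltry.
exists M; split; first exact: num_real.
by move=> N MN w Dw /=; apply: le_trans (ltW MN); exact: fM.
Qed.

(** The mean of the first [n] variables has second moment at most [1/n]. Along squares these bounds
    are summable, so the series of squared means has finite expectation, hence is almost surely
    finite, and its terms tend to 0. *)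
Lemma slln_orthogonal (d : measure_display) (T : measurableType d)
    (R : realType) (P : probability T R) (Y : nat -> T -> R) :
  (forall i, measurable_fun [set: T] (Y i)) ->
  (forall i w, `|Y i w| <= 1) ->
  (forall i j, i != j -> \int[P]_w (Y i w * Y j w) = 0) ->
  {ae P, forall w, n%:R^-1 * \sum_(i < n) Y i w @[n --> \oo] --> 0}.
Proof.
move=> mY Y1 Y0.
pose S n w := n%:R^-1 * \sum_(i < n) Y i w.
have mS n : measurable_fun [set: T] (S n).
  by apply: measurable_funM => //; exact: measurable_sum.
have YY1 i j w : `|Y i w * Y j w| <= 1.
  by rewrite normrM mulr_ile1.
have intYY i j : P.-integrable [set: T] (fun w => (Y i w * Y j w)%:E).
  apply: (@probability_integrable_bounded _ _ _ _ _ _ 1) => //.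
  exact: measurable_funM.
have S2 n : (\int[P]_w ((S n w) ^+ 2)%:E <= (n%:R^-1)%:E)%E.
  under eq_integral => w _ do
    rewrite /S exprMn (expr2 (\sum_(i < n) _)) big_distrlr/= EFinM.
  rewrite integralZl//; last first.
    under eq_fun do rewrite -sumEFin.
    apply: integrable_sum => // i _; under eq_fun do rewrite -sumEFin.
    by apply: integrable_sum => // j _.
  (* Orthogonality leaves only the diagonal of the expanded square. *)
  have -> : (\int[P]_w (\sum_(i < n) \sum_(j < n) Y i w * Y j w)%:E =
     \sum_(i < n) \int[P]_w (Y i w * Y i w)%:E)%E.
    under eq_integral => w _ do rewrite -sumEFin.
    rewrite integral_sum//; last first.
      move=> i; under eq_fun do rewrite -sumEFin.
      by apply: integrable_sum => // j _.
    apply: eq_bigr => i _.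
    under eq_integral => w _ do rewrite -sumEFin.
    rewrite integral_sum// (bigD1 i)//= big1 ?adde0// => j ji.
    have := @Y0 i j; rewrite eq_sym => /(_ ji) /eqP.
    (* [fine] also sends infinite values to 0, so integrability is what lifts the real identity to
       the extended one. *)
    rewrite /Rintegral fine_eq0 ?integrable_fin_num// => /eqP.
    exact.
  apply: (@le_trans _ _ ((n%:R^-1 ^+ 2)%:E * n%:R%:E)%E).
    apply: lee_wpmul2l; first by rewrite lee_fin sqr_ge0.
    rewrite -[X in (_ <= X%:R%:E)%E]card_ord -sum1_card natr_sum -sumEFin.
    apply: lee_sum => i _; apply: (@le_trans _ _ (\int[P]_w 1%:E)%E).
      apply: le_integral => //; first exact: finite_measure_integrable_cst.
      by move=> w _; rewrite lee_fin (le_trans (ler_norm _)).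
    by rewrite integral_cst// mul1e probability_le1.
  (* For the empty mean both sides vanish, as [0^-1 = 0]. *)
  rewrite -EFinM lee_fin; case: n => [|n]; first by rewrite mulr0 invr0.
  by rewrite expr2 -mulrA mulVf// mulr1.
pose f k w := ((S (k.+1 ^ 2)%N w) ^+ 2)%:E.
have mf k : measurable_fun [set: T] (f k).
  by apply/measurable_EFinP; apply: measurable_funX; exact: mS.
have f0 k w : [set: T] w -> (0 <= f k w)%E by move=> _; rewrite lee_fin sqr_ge0.
(* Nonnegativity of the terms allows exchanging integral and series. *)
have intf : (\int[P]_w (\sum_(0 <= k <oo) f k w) <= 2%:E)%E.
  rewrite integral_nneseries//; apply: lime_le.
    by apply: is_cvg_nneseries => k _ _; apply: integral_ge0 => w; exact: f0.
  apply: nearW => n;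
  apply: (@le_trans _ _ (\sum_(0 <= k < n) ((k.+1 ^ 2)%:R^-1)%:E)%E).
    by apply: lee_sum => k _; exact: S2.
  by rewrite sumEFin lee_fin sum_inv_squares_le2.
have : P.-integrable [set: T] (fun w => \sum_(0 <= k <oo) f k w)%E.
  apply/integrableP; split.
    by apply: ge0_emeasurable_sum => // k w _ _; exact: f0.
  under eq_integral => w _ do
    rewrite gee0_abs ?(nneseries_ge0 (fun k _ _ => f0 k w I))//.
  by rewrite (le_lt_trans intf)// ltry.
move/integrable_ae => /(_ measurableT) fae; apply: (filterS _ fae) => w /(_ I) fw.
apply: (@cvg_mean_of_squares _ (Y^~ w)) => //.
have /cvg_series_cvg_0 : cvgn (series (fun k => (S (k.+1 ^ 2)%N w) ^+ 2)).
  apply: nnseries_is_cvg => [i|]; first exact: sqr_ge0.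
  by rewrite -ge0_fin_numE//; apply: nneseries_ge0 => k _ _; exact: f0.
move=> /cvgr0Pnorm_le S20; apply/cvgr0Pnorm_le => e e0.
have e20 : 0 < e ^+ 2 by rewrite exprn_gt0.
apply: filterS (S20 _ e20) => k.
by rewrite normrX ler_pXn2r// nnegrE// ltW.
Qed.

(** * Integration against a sub-sigma-algebra *)

Lemma sigma_algebra_sub_measurable (d : measure_display)
    (T : measurableType d) (G : set (set T)) :
  G `<=` measurable -> <<s G >> `<=` measurable.
Proof. by move=> mG; apply: smallest_sub => //; exact: sigma_algebra_measurable. Qed.

Lemma measurable_fun_sub_sigma_algebra (d d' : measure_display)
    (T : measurableType d) (U : measurableType d') (G : set (set T))
    (g : T -> U) :
  G `<=` measurable ->
  measurable_fun [set: g_sigma_algebraType G]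
    (g : g_sigma_algebraType G -> U) ->
  measurable_fun [set: T] g.
Proof.
move=> mG mg _ B mB; rewrite setTI; apply: (sigma_algebra_sub_measurable mG).
by have := mg measurableT _ mB; rewrite setTI.
Qed.

(** Pushing [P] forward along the identity restricts it to [<<s G >>]. There both versions are
    measurable and have equal integrals over every measurable set, so they agree almost everywhere,
    and the null set found is also null for [P]. *)
Lemma is_cond_prob_ae_unique (d : measure_display) (T : measurableType d)
    (R : realType) (P : probability T R) (G : set (set T)) (A : set T)
    (f g : T -> R) :
  G `<=` measurable -> is_cond_prob P G A f -> is_cond_prob P G A g ->
  {ae P, forall w, f w = g w}.
Proof.
move=> mG [mf intf fE] [mg intg gE].
have midS : measurable_fun [set: T] (idfun : T -> g_sigma_algebraType G).
  by move=> _ B mB; rewrite setTI; exact: (sigma_algebra_sub_measurable mG).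
pose idm : {mfun T >-> g_sigma_algebraType G} :=
  HB.pack (idfun : T -> g_sigma_algebraType G)
    (isMeasurableFun.Build _ _ _ _ _ midS).
pose PS := distribution P idm.
have intE h B : <<s G >> B ->
    measurable_fun [set: g_sigma_algebraType G] (h : g_sigma_algebraType G -> R) ->
    P.-integrable [set: T] (EFin \o h) ->
    (\int[PS]_(w in B) (h w)%:E = \int[P]_(w in B) (h w)%:E)%E.
  move=> GB mh inth.
  rewrite /PS /distribution integral_pushforward//.
  - exact/measurable_EFinP.
  - apply: integrableS inth => //; exact: (sigma_algebra_sub_measurable mG).
have [N [mN N0 fgN]] :
    ae_eq PS [set: g_sigma_algebraType G] (EFin \o f) (EFin \o g).
  apply: integral_ae_eq => //.
  - by apply: integrable_pushforward => //; exact/measurable_EFinP.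
  - exact/measurable_EFinP.
  - by move=> E _ mE; rewrite (intE f)// (intE g)// fE// gE.
exists N; split => //; first exact: (sigma_algebra_sub_measurable mG).
move=> w /= fgw; apply: fgN => /= /(_ I) [].
exact: fgw.
Qed.

(* For [g] with values in [0,1], put [g' = 2 g - 1_{g >= 1/2}]. It has values in
   [0,1] again, and the integral of [h g] is half the integral of [h g']. *)
Lemma integral_orthogonal_sub_sigma (d : measure_display)
    (T : measurableType d) (R : realType) (P : probability T R)
    (G : set (set T)) (h g : T -> R) :
  G `<=` measurable -> measurable_fun [set: T] h -> (forall w, `|h w| <= 1) ->
  (forall B, <<s G >> B -> \int[P]_(w in B) h w = 0) ->
  measurable_fun [set: g_sigma_algebraType G] (g : g_sigma_algebraType G -> R) ->
  (forall w, 0 <= g w <= 1) ->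
  \int[P]_w (h w * g w) = 0.
Proof.
move=> mG mh h1 h0 mg g01.
have mT k : measurable_fun [set: g_sigma_algebraType G]
    (k : g_sigma_algebraType G -> R) -> measurable_fun [set: T] k.
  exact: measurable_fun_sub_sigma_algebra.
have inthg k : measurable_fun [set: g_sigma_algebraType G]
    (k : g_sigma_algebraType G -> R) -> (forall w, 0 <= k w <= 1) ->
    P.-integrable [set: T] (EFin \o (fun w => h w * k w)).
  move=> mk k01; apply: (@probability_integrable_bounded _ _ _ _ _ _ 1) => //.
    by apply: measurable_funM => //; exact: mT.
  move=> w _; have /andP[k0 k1] := k01 w.
  by rewrite normrM mulr_ile1// ger0_norm.
(* The bound is proved for all admissible [g] at once, so that the induction hypothesis applies to
   [g'] and each halving gains a factor 2. *)
suff bnd n : `|\int[P]_w (h w * g w)| <= 2 ^- n.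
  apply/eqP; rewrite -normr_le0; apply/ler_addgt0Pr => e e0; rewrite add0r.
  have [n _ /(_ n (leqnn n))] : \forall n \near \oo, 2 ^- n <= e :> R.
    have : @GRing.exp R 2^-1 @ \oo --> 0.
      by apply: cvg_expr; rewrite ger0_norm// invf_lt1// ltr1n.
    move=> /cvgr0Pnorm_le /(_ _ e0); apply: filterS => n.
    by rewrite ger0_norm exprVn ?invr_ge0 ?exprn_ge0.
  exact: le_trans.
elim: n g mg g01 => [|n IHn] g mg g01.
  rewrite expr0 invr1; apply: le_trans (le_normr_Rintegral _ _) _ => //.
    exact: inthg.
  have -> : 1 = \int[P]_(w in [set: T]) 1.
    rewrite Rintegral_cst// mul1r.
    exact: (esym (congr1 fine (probability_setT P))).
  apply: le_Rintegral => //.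
  - exact: integrable_norm (inthg _ _ _).
  - exact: finite_measure_integrable_cst.
  - move=> w _; have /andP[g0 g1] := g01 w.
    by rewrite normrM mulr_ile1// ger0_norm.
pose B : set T := [set w | 2^-1 <= g w].
have GB : <<s G >> B.
  have := mg measurableT `[2^-1, +oo[%classic; rewrite setTI.
  rewrite /B; set X := _ @^-1` _; have -> : X = [set w | 2^-1 <= g w].
    by apply/seteqP; split => w; rewrite /X/= in_itv/= andbT.
  by apply.
pose g' w := 2 * g w - \1_B w.
have mg' : measurable_fun [set: g_sigma_algebraType G] (g' : g_sigma_algebraType G -> R).
  apply: measurable_funB; first exact: measurable_funM.
  exact: measurable_indic.
have g'01 w : 0 <= g' w <= 1.
  have /andP[g0 g1] := g01 w.
  rewrite /g' indicE; have [/set_mem|] := boolP (w \in B); rewrite /B/=.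
    by move=> ?; apply/andP; split; lra.
  by rewrite notin_setE/= => /negP; rewrite -ltNge => ?; apply/andP; split; lra.
have := IHn _ mg' g'01.
have -> : \int[P]_w (h w * g w) = 2^-1 * \int[P]_w (h w * g' w).
  have mB : measurable B by exact: sigma_algebra_sub_measurable GB.
  have inth D : measurable D -> P.-integrable D (EFin \o h).
    move=> mD; apply: (@probability_integrable_bounded _ _ _ _ _ _ 1) => //.
    exact: measurable_funTS.
  have hB0 : \int[P]_w (h w * \1_B w) = 0.
    rewrite -[RHS](h0 _ GB) [RHS]Rintegral_mkcond; apply: eq_Rintegral => w _.
    by rewrite patchE indicE; case: ifP; rewrite ?mulr1 ?mulr0.
  have inthB : P.-integrable [set: T] (EFin \o (fun w => h w * \1_B w)).
    apply: inthg; first exact: measurable_indic.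
    by move=> w; rewrite indicE; case: (_ \in _); rewrite /= ?lexx ler01.
  rewrite -RintegralZl//; last exact: inthg.
  transitivity (\int[P]_w (2^-1 * (h w * g' w)) +
    \int[P]_w (2^-1 * (h w * \1_B w))).
    rewrite -RintegralD//.
    - by apply: eq_Rintegral => w _; rewrite /g'; lra.
    - by apply: (integrableZl measurableT 2^-1 (inthg _ _ _)).
    - exact: (integrableZl measurableT 2^-1 inthB).
  by rewrite [X in _ + X]RintegralZl ?hB0 ?mulr0 ?addr0.
by rewrite normrM [X in X * _]ger0_norm// exprS invfM ler_pM2l.
Qed.

(** * Moments of conditionally independent Bernoulli variables *)

Lemma measurable_bool_natr (d : measure_display) (T : measurableType d)
    (R : realType) (Z : T -> bool) :
  measurable_fun [set: T] Z -> measurable_fun [set: T] (fun w => (Z w)%:R : R).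
Proof.
by move=> mZ; apply: (@measurableT_comp _ _ _ _ _ _ (fun b : bool => b%:R : R) _ Z).
Qed.

Lemma measurable_cylinder (d : measure_display) (T : measurableType d)
    (n : nat) (Z : nat -> T -> bool) (x : 'I_n -> bool) :
  (forall i, measurable_fun [set: T] (Z i)) ->
  measurable [set w | forall i : 'I_n, Z i w = x i].
Proof.
move=> mZ.
have -> : [set w | forall i : 'I_n, Z i w = x i] =
    \bigcap_(i in [set: 'I_n]) (Z i @^-1` [set x i]).
  by apply/seteqP; split => [w Zx i _|w Zx i]; [exact: Zx|exact: (Zx i I)].
apply: fin_bigcap_measurable => [|i _]; first exact: finite_finset.
by rewrite -[_ @^-1` _]setTI; exact: mZ.
Qed.

Lemma measurable_rv_seq_events (d : measure_display) (T : measurableType d)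
    (R : realType) (P : probability T R) (theta : nat -> {RV P >-> R}) i :
  measurable_fun [set: g_sigma_algebraType (rv_seq_events theta)]
    (theta i : g_sigma_algebraType (rv_seq_events theta) -> R).
Proof.
move=> _ B mB; rewrite setTI; apply: sub_sigma_algebra.
by exists i => //; exists B => //; rewrite setTI.
Qed.

(** This is the mixed moment over [K] of independent Bernoulli variables with parameters [t i]. The
    sum over [x] factorizes over the coordinates: a coordinate in [K] contributes [t i], any other
    contributes [t i + (1 - t i) = 1]. *)
Lemma sum_bernoulli_weights (R : realType) (n : nat) (t : 'I_n -> R)
    (K : {set 'I_n}) :
  \sum_(x : {ffun 'I_n -> bool}) (\prod_(k in K) (x k)%:R) *
    (\prod_(i < n) (t i ^+ (x i) * (1 - t i) ^+ (1 - x i)%N)) =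
  \prod_(k in K) t k.
Proof.
pose F i (b : bool) := (if i \in K then b%:R else 1) *
  (t i ^+ b * (1 - t i) ^+ (1 - b)%N).
transitivity (\sum_(x : {ffun 'I_n -> bool}) \prod_(i < n) F i (x i)).
  by apply: eq_bigr => x _; rewrite [in LHS]big_mkcond/= -big_split.
rewrite -bigA_distr_bigA [RHS]big_mkcond/=.
apply: eq_bigr => i _; rewrite /F big_bool/= !expr1 !expr0.
by case: ifP => _; rewrite ?mulr1 ?mul1r ?mul0r ?addr0// addrCA subrr addr0.
Qed.

(** The product of the [X k] is a finite linear combination of cylinder indicators. Since [B] lies
    in the conditioning sigma-algebra, each indicator may be replaced under the integral by its
    conditional probability, and [sum_bernoulli_weights] evaluates the result. *)
Lemma integral_prod_cond_bernoulli (d : measure_display)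
    (T : measurableType d) (R : realType) (P : probability T R)
    (X : nat -> {RV P >-> bool}) (theta : nat -> {RV P >-> R}) (n : nat)
    (K : {set 'I_n.+1}) (B : set T) :
  (forall i w, 0 <= theta i w <= 1) ->
  {ae P, forall w, forall x : {ffun 'I_n.+1 -> bool},
    cond_prob P (rv_seq_events theta)
      [set w' | forall i : 'I_n.+1, X i w' = x i] w =
    \prod_(i < n.+1) (theta i w ^+ (x i) * (1 - theta i w) ^+ (1 - x i)%N)} ->
  <<s rv_seq_events theta >> B ->
  \int[P]_(w in B) (\prod_(k in K) (X k w)%:R) =
  \int[P]_(w in B) (\prod_(k in K) theta k w).
Proof.
move=> theta01 cpE GB; congr fine.
set G := rv_seq_events theta.
have mG : G `<=` measurable by exact: rv_seq_events_measurable.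
have mB : measurable B by exact: sigma_algebra_sub_measurable GB.
pose A (x : {ffun 'I_n.+1 -> bool}) := [set w | forall i : 'I_n.+1, X i w = x i].
pose c (x : {ffun 'I_n.+1 -> bool}) : R := \prod_(k in K) (x k)%:R.
have mA x : measurable (A x) by exact: (@measurable_cylinder _ _ n.+1 X).
have cpA x := cond_probP P mG (mA x).
have intA x : P.-integrable B (EFin \o cond_prob P G (A x)).
  have [_ h _] := cpA x; exact: (integrableS measurableT mB (@subsetT _ B) h).
have int1 x : P.-integrable B (fun w => (\1_(A x) w)%:E).
  apply: (integrableS measurableT mB (@subsetT _ B)).
  exact: integrable_indic.
transitivity (\sum_x (c x)%:E * P (A x `&` B))%E.
  transitivity (\int[P]_(w in B) (\sum_x (c x)%:E * (\1_(A x) w)%:E))%E.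
    apply: eq_integral => w _.
    (* The cylinders partition the space, so only the one through [w] contributes. *)
    pose x0 := [ffun i : 'I_n.+1 => X i w].
    rewrite (bigD1 x0)//= [X in _ = _ + X]big1 => [|x xx0].
      rewrite ?adde0 ?addr0 indicE mem_set ?mule1 => [|i]; last by rewrite ffunE.
      by congr EFin; apply: eq_bigr => k _; rewrite ffunE.
    rewrite indicE memNset ?mule0// => Axw; move/eqP: xx0; apply.
    by apply/ffunP => i; rewrite ffunE Axw.
  rewrite integral_sum//; last by move=> x; exact: (integrableZl mB _ (int1 x)).
  by apply: eq_bigr => x _; rewrite integralZl// integral_indic.
transitivity (\int[P]_(w in B) (\sum_x (c x)%:E * (cond_prob P G (A x) w)%:E))%E.
  rewrite integral_sum//; last by move=> x; exact: (integrableZl mB _ (intA x)).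
  apply: eq_bigr => x _; rewrite (integralZl mB (intA x)).
  by congr (_ * _)%E; have [_ _ cpB] := cpA x; rewrite -cpB.
apply: ae_eq_integral => //.
- apply: emeasurable_sum => x; apply: emeasurable_funM => //.
  exact: measurable_int (intA x).
- apply/measurable_EFinP/measurable_funTS; under eq_fun do rewrite -big_filter.
  apply: measurable_prod => k _.
  exact: measurable_funPT.
apply: filterS cpE => w cpw _.
rewrite -(sum_bernoulli_weights (fun k : 'I_n.+1 => theta k w) K) -sumEFin.
by apply: eq_bigr => x _; rewrite EFinM cpw.
Qed.

(** Orthogonality of the [Y i] is reduced to two facts: [X i * X j] and [theta i * theta j] have the
    same integral for distinct indices, and every [Y k] is orthogonal to every [theta l], because it
    integrates to 0 over each event of [<<s G >>]. *)
Lemma ae_cvg_mean_sub_cond_bernoulli (d : measure_display)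
    (T : measurableType d) (R : realType) (P : probability T R)
    (X : nat -> {RV P >-> bool}) (theta : nat -> {RV P >-> R}) :
  (forall i w, 0 <= theta i w <= 1) ->
  {ae P, forall w, forall n (x : {ffun 'I_n.+1 -> bool}),
    cond_prob P (rv_seq_events theta)
      [set w' | forall i : 'I_n.+1, X i w' = x i] w =
    \prod_(i < n.+1) (theta i w ^+ (x i) * (1 - theta i w) ^+ (1 - x i)%N)} ->
  {ae P, forall w,
    n%:R^-1 * \sum_(i < n) ((X i w)%:R - theta i w) @[n --> \oo] --> 0}.
Proof.
move=> theta01 cpE; set G := rv_seq_events theta.
have mG : G `<=` measurable by exact: rv_seq_events_measurable.
pose Y i w := (X i w)%:R - theta i w.
have mX i : measurable_fun [set: T] (fun w => (X i w)%:R : R).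
  by apply: measurable_bool_natr; exact: measurable_funPT.
have mY i : measurable_fun [set: T] (Y i) by exact: measurable_funB.
have Y1 i w : `|Y i w| <= 1.
  have /andP[t0 t1] := theta01 i w; rewrite /Y ler_norml.
  by case: (X i w) => /=; apply/andP; split; lra.
apply: (@slln_orthogonal _ _ _ _ Y) => // i j ij.
have int1 (f : T -> R) B : measurable B -> measurable_fun [set: T] f ->
    (forall w, `|f w| <= 1) -> P.-integrable B (EFin \o f).
  move=> mB mf f1; apply: (@probability_integrable_bounded _ _ _ _ _ _ 1) => //.
  exact: measurable_funTS.
have X1 k w : `|(X k w)%:R : R| <= 1 by case: (X k w); rewrite /= ?normr1 ?normr0.
have t1 k w : `|theta k w| <= 1.
  by have /andP[t0 t1] := theta01 k w; rewrite ger0_norm.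
have Y0 k B : <<s G >> B -> \int[P]_(w in B) Y k w = 0.
  move=> GB; have mB : measurable B by exact: sigma_algebra_sub_measurable GB.
  rewrite RintegralB//; try by apply: int1.
  have cpk : {ae P, forall w, forall x : {ffun 'I_k.+1 -> bool},
    cond_prob P G [set w' | forall i : 'I_k.+1, X i w' = x i] w =
    \prod_(i < k.+1) (theta i w ^+ (x i) * (1 - theta i w) ^+ (1 - x i)%N)}.
    by apply: filterS cpE => w /(_ k).
  (* [ord_max] is the index [k] itself, the last coordinate of the cylinders of length [k+1]. *)
  have := integral_prod_cond_bernoulli [set ord_max]%SET theta01 cpk GB.
  under eq_Rintegral do rewrite big_set1/=.
  under [in RHS]eq_Rintegral do rewrite big_set1/=.
  by move=> ->; rewrite subrr.
have Yt0 k l : \int[P]_w (Y k w * theta l w) = 0.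
  apply: (@integral_orthogonal_sub_sigma _ _ _ _ G) => //; first exact: Y0.
  exact: measurable_rv_seq_events.
have XX : \int[P]_w ((X i w)%:R * (X j w)%:R) = \int[P]_w (theta i w * theta j w).
  pose n := maxn i j.
  have iN : (i < n.+1)%N by rewrite ltnS leq_maxl.
  have jN : (j < n.+1)%N by rewrite ltnS leq_maxr.
  have cpn : {ae P, forall w, forall x : {ffun 'I_n.+1 -> bool},
    cond_prob P G [set w' | forall i : 'I_n.+1, X i w' = x i] w =
    \prod_(i < n.+1) (theta i w ^+ (x i) * (1 - theta i w) ^+ (1 - x i)%N)}.
    by apply: filterS cpE => w /(_ n).
  have GT : <<s G >> [set: T].
    exact: (@measurableT _ (g_sigma_algebraType G)).
  (* Here [i != j] matters: for equal indices the set would be a singleton and yield one factor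
     only. *)
  have pE (v : nat -> R) :
      \prod_(k in [set Ordinal iN; Ordinal jN]%SET) v k = v i * v j.
    by rewrite big_setU1 ?big_set1// inE -val_eqE.
  have := integral_prod_cond_bernoulli [set Ordinal iN; Ordinal jN]%SET theta01 cpn GT.
  under eq_Rintegral do rewrite (pE (fun k => (X k _)%:R)).
  by under [in RHS]eq_Rintegral do rewrite (pE (fun k => theta k _)).
have intM (f g : T -> R) : measurable_fun [set: T] f -> measurable_fun [set: T] g ->
   (forall w, `|f w| <= 1) -> (forall w, `|g w| <= 1) ->
   P.-integrable [set: T] (EFin \o (fun w => f w * g w)).
  move=> mf mg f1 g1; apply: int1 => //; first exact: measurable_funM.
  by move=> w; rewrite normrM mulr_ile1.
transitivity (\int[P]_w
  ((X i w)%:R * (X j w)%:R - theta i w * theta j w -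
   (Y i w * theta j w + Y j w * theta i w))).
  by apply: eq_Rintegral => w _; rewrite /Y; ring.
rewrite RintegralB//; last 2 first.
- by apply: (integrableB measurableT (intM _ _ _ _ _ _) (intM _ _ _ _ _ _)).
- by apply: (integrableD measurableT (intM _ _ _ _ _ _) (intM _ _ _ _ _ _)).
rewrite RintegralB//; try exact: intM.
by rewrite RintegralD ?Yt0 ?XX ?subrr ?addr0 ?subr0//; exact: intM.
Qed.

(** * Conditioning a binary sequence on itself *)

Lemma cylinder_rv_seq_events (d : measure_display) (T : measurableType d)
    (R : realType) (P : probability T R) (X : nat -> {RV P >-> bool})
    (theta : nat -> {RV P >-> R}) (n : nat) (x : 'I_n -> bool) :
  (forall i w, theta i w = (X i w)%:R) ->
  <<s rv_seq_events theta >> [set w | forall i : 'I_n, X i w = x i].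
Proof.
move=> thetaE;
apply: (@measurable_cylinder _ (g_sigma_algebraType (rv_seq_events theta)) n X).
move=> i; apply: (measurable_fun_bool true).
have -> : X i @^-1` [set true] = theta i @^-1` [set 1].
  apply/seteqP; split => w /=; rewrite thetaE; first by move=> ->.
  by case: (X i w) => // /eqP; rewrite eq_sym oner_eq0.
by apply: measurable_rv_seq_events => //; exact: measurable_set1.
Qed.

(** The cylinder belongs to the conditioning sigma-algebra, so its indicator is a version of its
    conditional probability; the product of weights equals that indicator pointwise. *)
Lemma cond_prob_cylinder_self (d : measure_display) (T : measurableType d)
    (R : realType) (P : probability T R) (X : nat -> {RV P >-> bool})
    (theta : nat -> {RV P >-> R}) (n : nat) (x : 'I_n -> bool) :
  (forall i w, theta i w = (X i w)%:R) ->
  {ae P, forall w,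
    cond_prob P (rv_seq_events theta) [set w' | forall i : 'I_n, X i w' = x i] w =
    \prod_(i < n) (theta i w ^+ (x i) * (1 - theta i w) ^+ (1 - x i)%N)}.
Proof.
move=> thetaE; set G := rv_seq_events theta; set A := [set w' | _].
have mG : G `<=` measurable by exact: rv_seq_events_measurable.
have GA : <<s G >> A by exact: cylinder_rv_seq_events.
have mA : measurable A by exact: sigma_algebra_sub_measurable GA.
(* A Bernoulli weight with parameter 0 or 1 is an equality test; the matching cases rely on
   [0 ^+ 0 = 1]. *)
have wE (b b' : bool) : (b%:R : R) ^+ b' * (1 - b%:R) ^+ (1 - b')%N =
    (b == b')%:R.
  by case: b; case: b'; rewrite /= ?subnn ?subn0 ?subrr ?subr0
    ?expr0 ?expr1 ?mulr1 ?mulr0 ?mul0r.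
have prodE w : \prod_(i < n) (theta i w ^+ (x i) * (1 - theta i w) ^+ (1 - x i)%N) =
    \1_A w.
  under eq_bigr do rewrite thetaE wE.
  rewrite indicE; have [/set_mem Aw|/negP nAw] := boolP (w \in A).
    by rewrite big1// => i _; rewrite Aw eqxx.
  have [i /eqP/negbTE Xi] : exists i : 'I_n, X i w <> x i.
    by apply/existsNP => h; apply: nAw; exact/mem_set.
  by rewrite (bigD1 i)//= Xi mul0r.
suff : {ae P, forall w, cond_prob P G A w = \1_A w}.
  by apply: filterS => w ->; rewrite prodE.
apply: (is_cond_prob_ae_unique mG (cond_probP P mG mA)); split.
- exact: (@measurable_indic _ (g_sigma_algebraType G)).
- exact: integrable_indic.
- by move=> B GB; rewrite integral_indic//; exact: sigma_algebra_sub_measurable GB.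
Qed.

(** * The law of large numbers and mixtures of independent Bernoulli variables *)

Theorem theorem2p1 (d : measure_display) (T : measurableType d) (R : realType)
    (P : probability T R) (p : R) (hp : 0 <= p <= 1)
    (X : nat -> {RV P >-> bool})
    (hX : forall i : nat, distribution P (X i) =1 bernoulli_prob p) :
  {ae P, forall w : T,
    (fun n : nat => n%:R^-1 * \sum_(i < n) (X i w)%:R) @ \oo --> p}
  <->
  exists theta : nat -> {RV P >-> R},
    [/\ forall (i : nat) (w : T), 0 <= theta i w <= 1,
        {ae P, forall w : T, forall (n : nat) (x : {ffun 'I_n.+1 -> bool}),
          cond_prob P (rv_seq_events theta)
            [set w' | forall i : 'I_n.+1, X i w' = x i] w =
          \prod_(i < n.+1)
            (theta i w ^+ (x i) * (1 - theta i w) ^+ (1 - x i)%N)} &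
        {ae P, forall w : T,
          (fun n : nat => n%:R^-1 * \sum_(i < n) theta i w) @ \oo --> p}].
Proof.
have mX i : measurable_fun [set: T] (fun w => (X i w)%:R : R).
  by apply: measurable_bool_natr; exact: measurable_funPT.
split=> [Xp|[theta [theta01 cpE thetap]]].
  pose theta i : {RV P >-> R} := HB.pack (fun w => (X i w)%:R : R)
    (isMeasurableFun.Build _ _ _ _ _ (mX i)).
  have thetaE i w : theta i w = (X i w)%:R by [].
  exists theta; split=> [i w|| //].
    by rewrite thetaE; case: (X i w); rewrite /= ?lexx ?ler01.
  (* The exceptional sets are merged over countably many [n] and, for each [n], finitely many words
     [x]. *)
  apply: ae_foralln => n.
  have cp (x : {ffun 'I_n.+1 -> bool}) := cond_prob_cylinder_self x thetaE.
  exact: filter_forall cp.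
have Y0 := ae_cvg_mean_sub_cond_bernoulli theta01 cpE.
apply: filterS2 Y0 thetap => w Y0 tp.
(* The means of [X] split into those of [X - theta], which tend to 0, and those of [theta], which
   tend to [p]. *)
rewrite (_ : (fun n : nat => _) =
    (fun n : nat => n%:R^-1 * \sum_(i < n) ((X i w)%:R - theta i w)) \+
    (fun n : nat => n%:R^-1 * \sum_(i < n) theta i w)).
  by rewrite -[p]add0r; exact: cvgD.
apply/funext => n /=; rewrite -mulrDr -big_split/=; congr (_ * _).
by apply: eq_bigr => i _; rewrite subrK.
Qed.
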